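(* Let $n\ge2$. In the cluster structure on $\mathrm{Mat}_n$ with initial quiver $Q_{CG}(n)$ and initial extended cluster $\{\theta_i\}_{i\in[n]}\cup\{\varphi_i\}_{i\in[N]}\cup\{\psi_i\}_{i\in[M]}$ (see context), the mutation of any function in the family $\{\theta_i\}_{i\in[n-1]}\cup\{\varphi_i\}_{i\in[N]}\cup\{\psi_i\}_{i\in[M]}$ except for $\varphi_N$ and $\psi_M$ results in a regular function on $\mathrm{Mat}_n$. That is, for each such function $f_v$ attached to the vertex $v$, the rational function $f_v'=f_v^{-1}\big(\prod_{v\to u}f_u+\prod_{u\to v}f_u\big)$ is a polynomial in the matrix entries of $X$.
   Context: Notation: $[a,b]=\{a,\dots,b\}$, $[m]=[1,m]$; $A_I^J$ is the submatrix with rows $I$ and columns $J$; $\mathrm{Mat}_n$ is the space of complex $n\times n$ matrices. Let $k=\lfloor\frac{n+1}2\rfloor$, $N=k(n-1)$, $M=N$ for $n$ even, $M=N-n+1$ for $n$ odd. Put $\mathcal X=[X_{[2,n]}\ 0]$, $\mathcal Y=[0\ Y_{[1,n-1]}]$ ($(n-1)\times(n+1)$ matrices) and let $U(X,Y)$ be the $k\times(k+1)$ block matrix whose $i$th block row has $\mathcal Y$ in block column $i$, $\mathcal X$ in block column $i+1$, and zeros elsewhere. Define $\theta_i(X)=\det X_{[n-i+1,n]}^{[n-i+1,n]}$, $i\in[n]$; $\varphi_i(X)=\det U(X,X)_{[N-i+1,N]}^{[k(n+1)-i+1,k(n+1)]}$, $i\in[N]$; $\psi_i(X)=\det U(X,X)_{[N-i+1,N]}^{[k(n+1)-i+2,k(n+1)+1]}$,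 $i\in[M]$. Each of these $n^2$ functions is attached to the vertex $(i,j)\in[n]\times[n]$ such that the upper left entry of the submatrix of $U(X,X)$ (or of $X$, for $\theta$) defining it is $x_{ij}$; this is a bijection. The frozen variables are $\theta_n$, $\varphi_N$, $\psi_M$. Quiver $Q_{CG}(n)$. Vertices: $[n]\times[n]$. Arrows: $(i,j+1)\to(i,j)$ for $i\in[n]$, $j\in[n-1]$ except $(i,j)=(1,n-1)$; $(i+1,j)\to(i,j)$ for $i\in[n-1]$, $j\in[n]$ except $(i,j)=(1,1)$; $(i,j)\to(i+1,j+1)$ for $i,j\in[n-1]$; $(n,j)\to(1,j)$ and $(1,j)\to(n,j+1)$ for $j\in[2,n-1]$; $(i,n)\to(i+2,1)$ and $(i+2,1)\to(i+1,n)$ for $i\in[1,n-2]$. *)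

(* Defs.v *)
From HB Require Import structures.
From mathcomp Require Import all_boot all_order all_algebra.
From mathcomp Require Import reals complex mpoly.

Set Implicit Arguments.
Unset Strict Implicit.
Unset Printing Implicit Defensive.

Import GRing.Theory.
Local Open Scope ring_scope.

Section Blocks.
Variable R : comNzRingType.

(* Entry of A in row r and column c, both counted from 1; 0 outside A. *)
Definition entry (p q : nat) (A : 'M[R]_(p, q)) (r c : nat) : R :=
  match (r, c) with
  | (r'.+1, c'.+1) =>
      if (insub r', insub c') is (Some i, Some j) then A i j else 0
  | _ => 0
  end.

(* A_{[r, r+s-1]}^{[c, c+t-1]}, with r and c counted from 1. *)
Definition block (p q : nat) (A : 'M[R]_(p, q)) (r c s t : nat) : 'M[R]_(s, t) :=
  \matrix_(i < s, j < t) entry A (r + i)%N (c + j)%N.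

Variable n : nat.

Definition kk : nat := ((n + 1) %/ 2)%N.
Definition NN : nat := (kk * (n - 1))%N.
Definition MM : nat := if odd n then (NN - n + 1)%N else NN.

(* [X_{[2,n]} 0] and [0 Y_{[1,n-1]}] *)
Definition calX (X : 'M[R]_n) : 'M[R]_(n - 1, n + 1) :=
  row_mx (block X 2 1 (n - 1) n) 0.

Definition calY (Y : 'M[R]_n) : 'M[R]_(n - 1, 1 + n) :=
  row_mx 0 (block Y 1 1 (n - 1) n).

(* Row r (from 0) of U lies in block row r %/ (n - 1), at offset r %% (n - 1);
   likewise for the columns with block width n + 1. *)
Definition U (X Y : 'M[R]_n) : 'M[R]_(NN, (kk + 1) * (n + 1)) :=
  \matrix_(r, c)
    let b := (r %/ (n - 1))%N in
    let d := (c %/ (n + 1))%N in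
    let r' := (r %% (n - 1)).+1 in
    let c' := (c %% (n + 1)).+1 in
    if d == b then entry (calY Y) r' c'
    else if d == b.+1 then entry (calX X) r' c'
    else 0.

Definition theta_mx (X : 'M[R]_n) (i : nat) : 'M[R]_i :=
  block X (n - i + 1)%N (n - i + 1)%N i i.

Definition phi_mx (X : 'M[R]_n) (i : nat) : 'M[R]_i :=
  block (U X X) (NN - i + 1)%N (kk * (n + 1) - i + 1)%N i i.

Definition psi_mx (X : 'M[R]_n) (i : nat) : 'M[R]_i :=
  block (U X X) (NN - i + 1)%N (kk * (n + 1) - i + 2)%N i i.

(* Names of the functions theta_i, phi_i, psi_i (in this order); an ordinal i
   stands for the index i + 1. *)
Definition label : Type := ('I_n + 'I_NN + 'I_MM)%type.
HB.instance Definition _ := Finite.on label.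

Definition label_size (l : label) : nat :=
  match l with
  | inl (inl i) => i.+1
  | inl (inr i) => i.+1
  | inr i => i.+1
  end.

Definition label_mx (X : 'M[R]_n) (l : label) : 'M[R]_(label_size l) :=
  match l return 'M[R]_(label_size l) with
  | inl (inl i) => theta_mx X i.+1
  | inl (inr i) => phi_mx X i.+1
  | inr i => psi_mx X i.+1
  end.

Definition cluster_fun (X : 'M[R]_n) (l : label) : R := \det (label_mx X l).

(* theta_n, phi_N and psi_M *)
Definition frozen (l : label) : bool :=
  match l with
  | inl (inl i) => i.+1 == n
  | inl (inr i) => i.+1 == NN
  | inr i => i.+1 == MM
  end.

End Blocks.

Definition vertex (n : nat) : Type := ('I_n * 'I_n)%type.
HB.instance Definition _ n := Finite.on (vertex n).

(* The quiver Q_CG(n).  The seven families of arrows are pairwise disjoint and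
   without repetition for n >= 2, so every arrow has multiplicity one. *)
Definition arrow (n : nat) (u v : vertex n) : bool :=
  let i := u.1.+1 in let j := u.2.+1 in
  let i' := v.1.+1 in let j' := v.2.+1 in
  [|| [&& i == i', j == j' + 1 & (i', j') != (1, n - 1)],
      [&& i == i' + 1, j == j' & (i', j') != (1, 1)],
      [&& i' == i + 1 & j' == j + 1],
      [&& i == n, i' == 1, j' == j & 2 <= j <= n - 1],
      [&& i == 1, i' == n, j' == j + 1 & 2 <= j <= n - 1],
      [&& j == n, j' == 1, i' == i + 2 & 1 <= i <= n - 2] |
      [&& j == 1, j' == n, i == i' + 1 & 2 <= i' <= n - 1]]%N.

Section Mutation.
Variables (K : fieldType) (n : nat).

(* Regular functions on Mat_n(K): one indeterminate per matrix entry. *)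
Local Notation matpoly := {mpoly K[n * n]}.

Definition genX : 'M[matpoly]_n := \matrix_(i, j) 'X_(mxvec_index i j).

(* The upper left entry of the submatrix named by l is the variable x_v. *)
Definition attached (l : label n) (v : vertex n) : bool :=
  entry (label_mx genX l) 1 1 == genX v.1 v.2.

(* f_v.  For n >= 2 exactly one label is attached to v, so the default 0 is
   never used. *)
Definition fun_at (v : vertex n) : matpoly :=
  if [pick l | attached l v] is Some l then cluster_fun genX l else 0.

Definition mutation (v : vertex n) : {fraction matpoly} :=
  (tofrac (fun_at v))^-1 *
  tofrac (\prod_(u | arrow v u) fun_at u + \prod_(u | arrow u v) fun_at u).

Definition is_regular (f : {fraction matpoly}) : Prop :=
  exists p : matpoly, f = tofrac p.

End Mutation.

(* Main.v *)
Require Import Defs.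
From mathcomp Require Import all_boot all_order all_algebra.
From mathcomp Require Import reals complex mpoly.
From mathcomp Require Import perm zify ring.

Import GRing.Theory.
Local Open Scope ring_scope.

(** Why the theorem holds.  Every exchange relation is a combination of two
    determinantal identities that share one auxiliary minor, and eliminating
    that minor leaves a multiple of the mutated function.

    Read U(X, X) backwards from its lower right corner, starting at column
    k(n+1)+1.  It becomes a single banded array [band X] that is invariant
    under the shift by (n-1, n+1).  In these coordinates psi_i is the leading
    principal i-minor of [band X], phi_i is the leading minor of the same array
    with its first column removed, and theta_i is a leading minor of the
    reversed matrix X, [rev_entry X].  For a leading minor f_i, let g_i be the
    minor with the same rows in which the last column is replaced by the next
    one ([lead_minor] and [skip_minor]).  The Desnanot-Jacobi identity, applied
    to an array and to the same array without its first row, reads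
    f_(i+2) f'_i = f_(i+1) g'_(i+1) - g_(i+1) f'_(i+1) ([desnanot_jacobi]).
    Suitable arrays turn it into a relation between neighbouring families:
    - bordering [band X] with the row e_0 relates phi to psi
      ([shifted_square]);
    - bordering the array of phi with the last row of X makes X itself the
      upper left block; that relates theta to phi for small sizes, and psi to
      phi for large ones, where the factor det X cancels ([theta_phi_square],
      [psi_phi_square]).

    The vertices are organised by the diagonals of the n x n grid.  Number them
    cyclically by d = 0, ..., n+1, where d = 0 and d = n+1 both denote the main
    diagonal, which carries the theta; an odd d between 1 and n carries n-1
    consecutive phi and an even one n-1 consecutive psi.  Let [diag X d s] be
    the function at step s of diagonal d.  Then for neighbouring diagonals
    f_(d,s+1) f_(d+1,s) = f_(d,s) g_(d+1,s+1) - g_(d,s) f_(d+1,s+1)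
    ([diag_square]).  The step from diagonal n back to the main diagonal uses
    that the minors continuing the families beyond diagonal n are block
    triangular: they are the theta multiplied by the frozen function phi_N
    (n even) or psi_M (n odd) ([chain_top]).  That factor can be cancelled
    because it does not vanish when X is the antidiagonal permutation matrix
    ([chain_top_antidiag]).

    Around a mutable f = f_(d,s), the square on the left has the form
    l1 f_(d,s-1) = l0 g - (...) f and the square on the right has the form
    f_(d,s+1) r0 = f (...) - g r1, with the same g = g_(d,s).  Hence f divides
    l1 f_(d,s-1) r1 + l0 f_(d,s+1) r0 ([exchange]), and those six functions sit
    at the neighbours of the vertex in the quiver.  For a theta, the left square
    is the one that leads to d = n+1 and the right one starts from d = 0.  The
    arrows that join opposite sides of the grid occur where a diagonal crosses
    from the first column to the last one, and where the sequence of phi, or of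
    psi, passes from the top of diagonal d to the bottom of diagonal d+2;
    absent neighbours correspond to minors of size 0 ([divides_mutable]). *)

(** * Leading minors of infinite arrays and the Desnanot-Jacobi identity *)

Lemma bump_ltn h i : (i < h)%N -> bump h i = i.
Proof. by rewrite /bump ltnNge => /negPf ->. Qed.

Section Minors.
Variable R : comNzRingType.
Implicit Types g h : nat -> nat -> R.

Definition lead_minor g m : R := \det (\matrix_(i < m, j < m) g i j).

(** The value 0 at size 0, where there is no last column to replace, is the one
    for which the identities below hold uniformly. *)
Definition skip_minor g m : R :=
  if m is p.+1 then lead_minor (fun i j => g i (bump p j)) m else 0.

Definition down g : nat -> nat -> R := fun i j => g i.+1 j.

Lemma eq_lead_minor g h m :
  (forall i j, (i < m)%N -> (j < m)%N -> g i j = h i j) ->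
  lead_minor g m = lead_minor h m.
Proof. by move=> eq_gh; congr (\det _); apply/matrixP => i j; rewrite !mxE eq_gh. Qed.

Lemma lead_minor0 g : lead_minor g 0 = 1.
Proof. exact: det_mx00. Qed.

Lemma lead_minor_ublock g a b :
  (forall i j, (i < b)%N -> (j < a)%N -> g (a + i)%N j = 0) ->
  lead_minor g (a + b) =
  lead_minor g a * lead_minor (fun i j => g (a + i)%N (a + j)%N) b.
Proof.
move=> g0; rewrite /lead_minor -[X in \det X]submxK.
have -> : dlsubmx (\matrix_(i < a + b, j < a + b) g i j) = 0.
  by apply/matrixP => i j; rewrite !mxE /= g0 //=.
by rewrite det_ublock; congr (_ * _); congr (\det _); apply/matrixP => i j; rewrite !mxE.
Qed.

Lemma lead_minor_lblock g a b :
  (forall i j, (i < a)%N -> (j < b)%N -> g i (a + j)%N = 0) ->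
  lead_minor g (a + b) =
  lead_minor g a * lead_minor (fun i j => g (a + i)%N (a + j)%N) b.
Proof.
move=> g0; rewrite /lead_minor -[X in \det X]submxK.
have -> : ursubmx (\matrix_(i < a + b, j < a + b) g i j) = 0.
  by apply/matrixP => i j; rewrite !mxE /= g0 //=.
by rewrite det_lblock; congr (_ * _); congr (\det _); apply/matrixP => i j; rewrite !mxE.
Qed.

Lemma lead_minor1 g : lead_minor g 1 = g 0%N 0%N.
Proof. by rewrite /lead_minor det_mx11 mxE. Qed.

Lemma lead_minor2 g :
  lead_minor g 2 = g 0%N 0%N * g 1%N 1%N - g 0%N 1%N * g 1%N 0%N.
Proof.
rewrite /lead_minor (expand_det_row _ ord0) !big_ord_recl big_ord0 addr0.
by rewrite /cofactor !det_mx11 !mxE /= /bump /=; ring.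
Qed.

(** The rows and the columns are reversed by the same permutation, so the two
    signs cancel. *)
Lemma lead_minor_rev g m :
  lead_minor (fun i j => g (m - i.+1)%N (m - j.+1)%N) m = lead_minor g m.
Proof.
pose s := perm (@rev_ord_inj m).
rewrite /lead_minor -[RHS]mulr1 -(@sqrr_sign R s) expr2.
have <- : row_perm s (col_perm s (\matrix_(i, j) g i j)) =
       \matrix_(i < m, j < m) g (m - i.+1)%N (m - j.+1)%N.
  by apply/matrixP => i j; rewrite !mxE !permE.
by rewrite row_permE col_permE !det_mulmx !det_perm odd_permV mulrCA.
Qed.

Lemma lead_minor_id m : lead_minor (fun i j => (i == j)%:R) m = 1.
Proof.
by rewrite /lead_minor -[RHS](det1 R m); congr (\det _); apply/matrixP => i j; rewrite !mxE.
Qed.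

(** Let A be the array truncated to size m+2 and K the identity matrix with its
    last two columns replaced by the first and the last columns of adj A.  Then
    A K agrees with A in the first m columns and has multiples of e_0 and
    e_(m+1) in the last two; taking determinants gives the claim. *)
Lemma desnanot_jacobi_scaled g m :
  lead_minor g m.+2 ^+ 2 * lead_minor (down g) m =
  lead_minor g m.+2 * (lead_minor g m.+1 * skip_minor (down g) m.+1 -
                       skip_minor g m.+1 * lead_minor (down g) m.+1).
Proof.
pose A := \matrix_(i < m.+2, j < m.+2) g i j; pose D := \det A.
pose cof i j := (-1) ^+ (i + j) *
  lead_minor (fun a b => g (bump i a) (bump j b)) m.+1.
have adjE i j : (\adj A) i j = cof j i.
  rewrite mxE /cofactor /cof; congr (_ * \det _).
  by apply/matrixP => a b; rewrite !mxE.
pose k i j := if (j < m)%N then (i == j)%:R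
              else if j == m then cof 0%N i else cof m.+1 i.
pose h i j := if (j < m)%N then g i j
              else if j == m then D * (i == 0%N)%:R else D * (i == m.+1)%:R.
have AKE : A *m \matrix_(i, j) k i j = \matrix_(i < m.+2, j < m.+2) h i j.
  have adjC (j : 'I_m.+2) i : \sum_(l < m.+2) A i l * cof j l = D * (i == j)%:R.
    have /matrixP/(_ i j) := mul_mx_adj A; rewrite !mxE mulr_natr => <-.
    by apply: eq_bigr => l _; rewrite adjE.
  apply/matrixP => i j; rewrite !mxE /h; case: ltnP => [ltjm|lemj].
    rewrite (bigD1 j) //= big1 => [|l nelj]; rewrite !mxE /k ltjm.
      by rewrite eqxx mulr1 addr0.
    by rewrite val_eqE (negPf nelj) mulr0.
  case: eqVneq => [ejm|nejm].
    rewrite -[0%N]/(val (ord0 : 'I_m.+2)) val_eqE -adjC.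
    by apply: eq_bigr => l _; rewrite !mxE /k ejm ltnn eqxx.
  rewrite -[m.+1]/(val (ord_max : 'I_m.+2)) val_eqE -adjC.
  apply: eq_bigr => l _; rewrite !mxE /k (negPf nejm).
  by rewrite ltnNge lemj.
have detK : lead_minor k m.+2 =
  (-1) ^+ m * (lead_minor g m.+1 * skip_minor (down g) m.+1 -
       skip_minor g m.+1 * lead_minor (down g) m.+1).
  rewrite -addn2 lead_minor_ublock => [|i j _ ltjm]; last first.
    by rewrite /k ltjm; case: eqP => //; lia.
  rewrite (@eq_lead_minor _ (fun i j => (i == j)%:R)) => [|i j _ ltjm]; last first.
    by rewrite /k ltjm.
  rewrite lead_minor_id mul1r lead_minor2 /k !addn0 !addn1 !ltnn.
  rewrite eqxx [(m.+1 < m)%N]ltnNge leqnSn /= gtn_eqF // /cof.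
  rewrite -/(skip_minor g m.+1) -/(skip_minor (down g) m.+1) !add0n !exprD !exprS.
  have -> : lead_minor (fun a b => g (bump m.+1 a) (bump m.+1 b)) m.+1 =
            lead_minor g m.+1.
    by apply: eq_lead_minor => i j lti ltj; rewrite !bump_ltn.
  have -> : lead_minor (fun a b => g (bump m.+1 a) (bump m b)) m.+1 =
            skip_minor g m.+1.
    by apply: eq_lead_minor => i j lti ltj; rewrite (bump_ltn _ i).
  have -> : lead_minor (fun a b => g (bump 0 a) (bump m.+1 b)) m.+1 =
            lead_minor (down g) m.+1.
    by apply: eq_lead_minor => i j lti ltj; rewrite (bump_ltn _ j).
  have e2 : (-1 : R) ^+ m * (-1) ^+ m = 1 by rewrite -expr2 sqrr_sign.
  ring: e2.
have detH : lead_minor h m.+2 = (-1) ^+ m * D ^+ 2 * lead_minor (down g) m.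
  rewrite -addn1 -addSnnS addn0 -[m.+2]addn1 lead_minor_lblock => [|i j lti ltj]; last first.
    rewrite /h; case: ltnP; first by lia.
    by case: eqP; [lia | case: eqP; [lia | rewrite mulr0]].
  rewrite lead_minor1 !addn0 {2}/h ltnNge leqnSn /= gtn_eqF // eqxx mulr1.
  rewrite {1}/lead_minor (expand_det_col _ ord_max) (bigD1 ord0) //= big1 => [|i nei0].
    rewrite !mxE {1}/h ltnn eqxx /= mulr1 /cofactor add0n addr0.
    rewrite -/(lead_minor _ _).
    have -> : row' ord0 (col' ord_max (\matrix_(i < m.+1, j < m.+1) h i j)) =
       \matrix_(i < m, j < m) down g i j.
      by apply/matrixP => i j; rewrite !mxE /h /= bump_ltn ?ltn_ord.
    rewrite -/(lead_minor _ _); ring.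
  rewrite !mxE /h ltnn eqxx -[0%N]/(val (ord0 : 'I_m.+1)) val_eqE (negPf nei0).
  by rewrite mulr0 mul0r.
have := congr1 determinant AKE; rewrite det_mulmx -!/(lead_minor _ _) detK detH.
have e2 : (-1 : R) ^+ m * (-1) ^+ m = 1 by rewrite -expr2 sqrr_sign.
rewrite -/(lead_minor g _) -/D; move: e2; set s := (-1) ^+ m => e2 eqD.
have -> : D ^+ 2 * lead_minor (down g) m =
          s * (s * D ^+ 2 * lead_minor (down g) m) by ring: e2.
by rewrite -eqD; ring: e2.
Qed.

End Minors.

Arguments lead_minor {R} g m.
Arguments skip_minor {R} g m : simpl never.
Arguments down {R} g i j /.

Section DesnanotJacobi.
Variables (R : idomainType).

(** The factor det A of the scaled identity is removed by perturbing A to A + t I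
    over the polynomials in t: that determinant is a characteristic polynomial,
    hence nonzero, and t = 0 gives back A. *)
Lemma desnanot_jacobi (g : nat -> nat -> R) m :
  lead_minor g m.+2 * lead_minor (down g) m =
  lead_minor g m.+1 * skip_minor (down g) m.+1 -
  skip_minor g m.+1 * lead_minor (down g) m.+1.
Proof.
pose G i j : {poly R} := (g i j)%:P + 'X *+ (i == j).
have hornerD (f : nat -> nat -> {poly R}) p :
    (lead_minor f p).[0] = lead_minor (fun i j => (f i j).[0]) p.
  rewrite -horner_evalE /lead_minor -det_map_mx; congr (\det _).
  by apply/matrixP => i j; rewrite !mxE.
have G0 i j : (G i j).[0] = g i j.
  by rewrite /G !(hornerE, hornerMn) mul0rn addr0.
have detG_neq0 : lead_minor G m.+2 != 0.
  have -> : lead_minor G m.+2 = char_poly (- \matrix_(i < m.+2, j < m.+2) g i j).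
    congr (\det _); apply/matrixP => i j.
    by rewrite !mxE /G polyCN opprK addrC.
  exact: monic_neq0 (char_poly_monic _).
have /(mulfI detG_neq0) : lead_minor G m.+2 * (lead_minor G m.+2 * lead_minor (down G) m) =
   lead_minor G m.+2 * (lead_minor G m.+1 * skip_minor (down G) m.+1 -
  skip_minor G m.+1 * lead_minor (down G) m.+1).
  by rewrite -desnanot_jacobi_scaled expr2 mulrA.
move/(congr1 (horner^~ 0)); rewrite !(hornerE, hornerM) /skip_minor !hornerD.
have eqG p f f' : lead_minor (fun i j => (G (f i) (f' j)).[0]) p =
    lead_minor (fun i j => g (f i) (f' j)) p by apply: eq_lead_minor => *.
by rewrite /down; rewrite !eqG.
Qed.
End DesnanotJacobi.

(** * The matrix U read from its lower right corner *)

Section Entries.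
Variable R : comNzRingType.

Lemma entry_ord p q (A : 'M[R]_(p, q)) (i : 'I_p) (j : 'I_q) :
  entry A i.+1 j.+1 = A i j.
Proof. by rewrite /entry !valK. Qed.

Lemma entry_gt_col p q (A : 'M[R]_(p, q)) r c : (q < c)%N -> entry A r c = 0.
Proof.
case: c => // c ltqc; case: r => // r; rewrite /entry [insub c]insubF; last by lia.
by case: insub.
Qed.

Lemma entry0l p q (A : 'M[R]_(p, q)) c : entry A 0 c = 0.
Proof. by []. Qed.

Lemma entry0r p q (A : 'M[R]_(p, q)) r : entry A r 0 = 0.
Proof. by case: r. Qed.

Variables (n : nat) (X : 'M[R]_n).

Lemma entry_calX r c : (r < n - 1)%N ->
  entry (calX X) r.+1 c.+1 = entry X r.+2 c.+1.
Proof.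
move=> ltr; have [ltc|lenc] := ltnP c (n + 1); last first.
  by rewrite !entry_gt_col //; lia.
rewrite (entry_ord _ _ (calX X) (Ordinal ltr) (Ordinal ltc)) mxE.
case: splitP => j /= ej; rewrite !mxE ?ej //=.
by rewrite entry_gt_col //; lia.
Qed.

Lemma entry_calY r c : (r < n - 1)%N -> 
  entry (calY X) r.+1 c.+1 = entry X r.+1 c.
Proof.
move=> ltr; have [ltc|lenc] := ltnP c (1 + n); last first.
  by rewrite !entry_gt_col //; lia.
rewrite (entry_ord _ _ (calY X) (Ordinal ltr) (Ordinal ltc)) mxE.
case: splitP => j /= ej; rewrite !mxE ?ej //=.
by rewrite ord1 entry0r.
Qed.

(** Reversed indices start at 0 at the lower right entry; for an index n or more,
    truncated subtraction yields row or column 0, where [entry] is 0. *)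
Definition rev_entry a b : R := entry X (n - a) (n - b).

(** Row s lies in the q-th block row from the bottom.  It consists of the row of X
    with reversed index r followed, without a gap, by the one with reversed index
    r+1, which begins in column [d]. *)
Definition band s t : R :=
  let q := (s %/ (n - 1))%N in let r := (s %% (n - 1))%N in
  let d := (q * (n + 1)).+1 in
  if (d <= t)%N then rev_entry r.+1 (t - d)
  else if (d <= t + n)%N then rev_entry r (t + n - d) else 0.

Lemma rev_entry_ge_col a b : (n <= b)%N -> rev_entry a b = 0.
Proof. by rewrite /rev_entry -subn_eq0 => /eqP->; rewrite entry0r. Qed.

Hypothesis n_ge2 : (2 <= n)%N.

Lemma band_period s t : band (n - 1 + s) (n + 1 + t) = band s t.
Proof.
rewrite /band divnDl ?divnn // modnDl.
have -> : (0 < n - 1)%N by lia.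
set q := (s %/ (n - 1))%N.
have -> : (((true + q) * (n + 1)).+1 = n + 1 + (q * (n + 1)).+1)%N.
  by rewrite [nat_of_bool _]/= mulnDl mul1n; lia.
rewrite leq_add2l.
case: ifP => _; first by congr rev_entry; lia.
by rewrite -[(_ + t + n)%N]addnA leq_add2l; case: ifP => // _; congr rev_entry; lia.
Qed.

Lemma band_bottom s t : (s < n - 1)%N -> band s t.+1 = rev_entry s.+1 t.
Proof. by move=> lts; rewrite /band divn_small // modn_small //= subn1. Qed.

(** Column 0 of the band is column k(n+1)+1 of U, the last column of every psi. *)
Lemma entry_U s t : (s < NN n)%N -> (t <= kk n * (n + 1))%N ->
  entry (U X X) (NN n - s) (kk n * (n + 1) + 1 - t) = band s t.
Proof.
move=> lts let_.
have ltr : (NN n - s.+1 < NN n)%N by lia.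
have ltc : (kk n * (n + 1) - t < (kk n + 1) * (n + 1))%N by rewrite mulnDl; lia.
have -> : (NN n - s = (NN n - s.+1).+1)%N by lia.
have -> : (kk n * (n + 1) + 1 - t = (kk n * (n + 1) - t).+1)%N by lia.
rewrite (entry_ord _ _ (U X X) (Ordinal ltr) (Ordinal ltc)) mxE /=.
have n1_gt0 : (0 < n - 1)%N by lia.
rewrite /band; set q := (s %/ (n - 1))%N; set r := (s %% (n - 1))%N.
have es : (s = q * (n - 1) + r)%N by apply: divn_eq.
have r_lt : (r < n - 1)%N by apply: ltn_pmod.
have q_lt : (q < kk n)%N by rewrite ltn_divLR.
have er : (NN n - s.+1 = (kk n - q.+1) * (n - 1) + (n - 2 - r))%N.
  by rewrite /NN es mulnBl mulSn; nia.
have -> : ((NN n - s.+1) %/ (n - 1) = kk n - q.+1)%N.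
  by rewrite er divnMDl // divn_small ?addn0 //; lia.
have -> : ((NN n - s.+1) %% (n - 1) = n - 2 - r)%N.
  by rewrite er modnMDl modn_small //; lia.
set c := (kk n * (n + 1) - t)%N.
have ec := divn_eq c (n + 1).
have ltcm : (c %% (n + 1) < n + 1)%N by rewrite ltn_pmod // addn1.
move: (c %/ (n + 1))%N (c %% (n + 1))%N ec ltcm => d c' ec ltcm.
rewrite entry_calX ?entry_calY; try lia.
have ec2 : (kk n * (n + 1) = d * (n + 1) + c' + t)%N by lia.
have [p ep] : exists p, (kk n = q.+1 + p)%N by exists (kk n - q.+1)%N; lia.
have eb : (kk n - q.+1 = p)%N by lia.
rewrite eb; rewrite ep !mulnDl mulSn in ec2.
case: eqVneq => [ed|ned].
  have et : (t + c' = (q * (n + 1)) + (n + 1))%N by rewrite ed in ec2; lia.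
  case: c' ltcm ec ec2 et => [|c'] ltcm ec ec2 et.
    rewrite entry0r ifT; last by lia.
    by rewrite rev_entry_ge_col //; lia.
  rewrite ifT; last by lia.
  by rewrite /rev_entry; congr (entry _ _ _); lia.
case: eqVneq => [ed|ned'].
  have et : (t + c' = q * (n + 1))%N by rewrite ed mulSn in ec2; lia.
  rewrite ifF; last by lia.
  case: ifP => ht; first by rewrite /rev_entry; congr (entry _ _ _); lia.
  by rewrite entry_gt_col //; lia.
have [ltdp|ltpd] : (d < p)%N \/ (p.+1 < d)%N by lia.
  have : (d.+1 * (n + 1) <= p * (n + 1))%N by rewrite leq_mul2r ltdp orbT.
  rewrite mulSn => ?; rewrite ifT; last by lia.
  by rewrite rev_entry_ge_col //; lia.
have : (p.+2 * (n + 1) <= d * (n + 1))%N by rewrite leq_mul2r ltpd orbT.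
by rewrite !mulSn => le_pd; rewrite !ifF //; clear -ec2 le_pd n_ge2; lia.
Qed.

Lemma det_theta i : (i <= n)%N -> \det (theta_mx X i) = lead_minor rev_entry i.
Proof.
move=> lein; rewrite -lead_minor_rev; congr (\det _).
apply/matrixP => a b; rewrite !mxE /rev_entry.
have := ltn_ord a; have := ltn_ord b => *. by congr (entry _ _ _); lia.
Qed.

Lemma leq_NN_kk : (NN n <= kk n * (n + 1))%N.
Proof. by rewrite /NN leq_mul2l; lia. Qed.

Lemma det_phi i : (i <= NN n)%N ->
  \det (phi_mx X i) = lead_minor (fun s t => band s t.+1) i.
Proof.
move=> leiN; have := leq_NN_kk; rewrite -lead_minor_rev => leNC.
congr (\det _); apply/matrixP => a b; rewrite !mxE.
have := ltn_ord a; have := ltn_ord b => ltb lta.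
by rewrite -entry_U; try lia; congr (entry _ _ _); lia.
Qed.

Lemma det_psi i : (i <= NN n)%N -> \det (psi_mx X i) = lead_minor band i.
Proof.
move=> leiN; have := leq_NN_kk; rewrite -lead_minor_rev => leNC.
congr (\det _); apply/matrixP => a b; rewrite !mxE.
have := ltn_ord a; have := ltn_ord b => ltb lta.
by rewrite -entry_U; try lia; congr (entry _ _ _); lia.
Qed.

End Entries.

Arguments rev_entry {R n} X a b.
Arguments band {R n} X s t.

(** * Relations between neighbouring families of minors *)

Section Squares.
Variable R : idomainType.

(** Desnanot-Jacobi for [g] bordered on top by the row e_0: expanding along that
    row removes the first column, and dropping it restores [g]. *)
Lemma shifted_square (g g' : nat -> nat -> R) i :
  (forall s t, g' s t = g s t.+1) ->
  lead_minor g' i.+1 * lead_minor g i =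
  lead_minor g' i * skip_minor g i.+1 - skip_minor g' i * lead_minor g i.+1.
Proof.
move=> g'E.
pose A s t : R := if s is s'.+1 then g s' t else (t == 0%N)%:R.
have leadA m : lead_minor A m.+1 = lead_minor g' m.
  rewrite -add1n lead_minor_lblock => [|[|s] t //].
  rewrite lead_minor1 mul1r; apply: eq_lead_minor => s t _ _.
  by rewrite !add1n g'E.
have skipA m : skip_minor A m.+1 = skip_minor g' m.
  case: m => [|m]; first by rewrite /skip_minor lead_minor1.
  rewrite /skip_minor -[m.+2]add1n lead_minor_lblock => [|[|s] t //]; last first.
    by rewrite /= add1n bumpS.
  rewrite lead_minor1 mul1r; apply: eq_lead_minor => s t _ _.
  by rewrite !add1n bumpS g'E.
by have := desnanot_jacobi R A i; rewrite !leadA skipA.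
Qed.

Variables (n : nat) (X : 'M[R]_n).
Hypothesis n_ge2 : (2 <= n)%N.
Local Notation y := (rev_entry X).
Local Notation w := (band X).
Local Notation w1 := (fun s t => w s t.+1).

(** The array of phi bordered on top by the last row of X.  Its first n rows are
    then the reversed X followed by zeros, and below and to the right of that
    block the band starts again. *)
Definition topped s t := if (s < n)%N then y s t else w s.-1 t.+1.

Lemma lead_topped i : (i <= n)%N -> lead_minor topped i = lead_minor y i.
Proof.
move=> lein; apply: eq_lead_minor => s t lts _.
by rewrite /topped (leq_trans lts lein).
Qed.

Lemma skip_topped i : (i <= n)%N -> skip_minor topped i = skip_minor y i.
Proof.
case: i => // i lein; apply: eq_lead_minor => s t lts _.
by rewrite /topped (leq_trans lts lein).
Qed.

Lemma topped_period s t : topped (n + s) (n + t) = w s t.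
Proof.
rewrite /topped ltnNge leq_addr /= -[RHS]band_period //.
by congr band; lia.
Qed.

Lemma lead_topped_add j :
  lead_minor topped (n + j) = lead_minor y n * lead_minor w j.
Proof.
rewrite lead_minor_lblock => [|s t lts _]; last first.
  by rewrite /topped lts rev_entry_ge_col // leq_addr.
rewrite lead_topped //; congr (_ * _).
by apply: eq_lead_minor => s t _ _; rewrite topped_period.
Qed.

Lemma skip_topped_add j :
  skip_minor topped (n + j) = lead_minor y n * skip_minor w j.
Proof.
case: j => [|j].
  rewrite addn0 mulr0; have -> : n = n.-1.+1 by lia.
  rewrite /skip_minor /lead_minor (expand_det_col _ ord_max) big1 // => s _.
  rewrite mxE /= /bump leqnn /topped ifT; last by have := ltn_ord s; lia.
  by rewrite rev_entry_ge_col ?mul0r //; lia.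
rewrite addnS /skip_minor -addnS lead_minor_lblock => [|s t lts _]; last first.
  by rewrite /topped lts rev_entry_ge_col // /bump; lia.
congr (_ * _).
  rewrite -lead_topped //; apply: eq_lead_minor => s t _ ltt.
  by rewrite bump_ltn //; lia.
apply: eq_lead_minor => s t _ _; rewrite -topped_period.
by congr topped; rewrite /bump; lia.
Qed.

Lemma down_topped s t : down topped s t = w s t.+1.
Proof.
by rewrite /= /topped /=; case: ltnP => // ltsn; rewrite band_bottom //; lia.
Qed.

Lemma lead_down_topped i : lead_minor (down topped) i = lead_minor w1 i.
Proof. by apply: eq_lead_minor => s t _ _; rewrite down_topped. Qed.

Lemma skip_down_topped i : skip_minor (down topped) i = skip_minor w1 i.
Proof. by case: i => // i; apply: eq_lead_minor => s t _ _; rewrite down_topped. Qed.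

Lemma theta_phi_square i : (i.+2 <= n)%N ->
  lead_minor y i.+2 * lead_minor w1 i =
  lead_minor y i.+1 * skip_minor w1 i.+1 - skip_minor y i.+1 * lead_minor w1 i.+1.
Proof.
move=> lein; have := desnanot_jacobi R topped i.
rewrite !lead_down_topped skip_down_topped !lead_topped ?skip_topped //; exact: ltnW.
Qed.

(** The minors of [topped] of size at least n are det X times the psi, so this is
    Desnanot-Jacobi divided by det X. *)
Lemma psi_phi_square j : lead_minor y n != 0 ->
  lead_minor w j.+1 * lead_minor w1 (j + (n - 1)) =
  lead_minor w j * skip_minor w1 (j + (n - 1)).+1 -
  skip_minor w j * lead_minor w1 (j + (n - 1)).+1.
Proof.
move=> detX_neq0; apply: (mulfI detX_neq0).
have := desnanot_jacobi R topped (j + (n - 1)).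
rewrite !lead_down_topped skip_down_topped.
have -> : ((j + (n - 1)).+2 = n + j.+1)%N by lia.
have -> : ((j + (n - 1)).+1 = n + j)%N by lia.
by rewrite !lead_topped_add skip_topped_add mulrBr !mulrA.
Qed.

(** Diagonal d carries the phi (d odd) or the psi (d even) of the sizes
    (n-1) * floor((d-1)/2) + s, where s = 1, ..., n-1; outside that range of s the
    same formula gives the functions on diagonals d - 2 and d + 2. *)
Definition chain_size d s := ((n - 1) * d.-1./2 + s)%N.
Definition chain_array d s t : R := w s (t + odd d).

Definition chain d s : R := lead_minor (chain_array d) (chain_size d s).
Definition skip_chain d s : R := skip_minor (chain_array d) (chain_size d s).

Lemma chain_arrayE (f : (nat -> nat -> R) -> nat -> R) d i :
  (forall g h, (forall s t, g s t = h s t) -> f g i = f h i) ->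
  f (chain_array d) i = if odd d then f w1 i else f w i.
Proof.
by move=> eqf; case: ifP => odd_d; apply: eqf => s t; rewrite /chain_array odd_d ?addn1 ?addn0.
Qed.

Lemma lead_chain_array d i :
  lead_minor (chain_array d) i = if odd d then lead_minor w1 i else lead_minor w i.
Proof. by apply: (chain_arrayE lead_minor) => *; apply: eq_lead_minor. Qed.

Lemma skip_chain_array d i :
  skip_minor (chain_array d) i = if odd d then skip_minor w1 i else skip_minor w i.
Proof.
apply: (chain_arrayE skip_minor) => *.
by case: i => // i; apply: eq_lead_minor.
Qed.

Lemma chain_square d s : lead_minor y n != 0 -> (0 < d)%N ->
  chain d s.+1 * chain d.+1 s =
  chain d s * skip_chain d.+1 s.+1 - skip_chain d s * chain d.+1 s.+1.
Proof.
move=> detX_neq0 d_gt0; rewrite /chain /skip_chain !lead_chain_array !skip_chain_array.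
rewrite oddS /chain_size !addnS; case: d d_gt0 => // d _; rewrite oddS -pred_Sn -uphalfE.
case: (boolP (odd d)) => odd_d /=; rewrite uphalf_half ?odd_d ?(negPf odd_d) /=.
  have -> : ((n - 1) * (true + d./2) + s = (n - 1) * d./2 + s + (n - 1))%N.
    by rewrite [nat_of_bool _]/= mulnDr muln1; lia.
  exact: psi_phi_square.
exact: shifted_square.
Qed.

End Squares.

Arguments chain_array {R n} X d s t.
Arguments chain {R n} X d s.
Arguments skip_chain {R n} X d s.

(** * Closing the cycle of diagonals at the main diagonal *)

Section Closing.
Variables (R : idomainType) (n : nat) (X : 'M[R]_n).
Hypothesis n_ge2 : (2 <= n)%N.
Local Notation y := (rev_entry X).
Local Notation w := (band X).
Local Notation chain := (chain X).
Local Notation skip_chain := (skip_chain X).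
Local Notation N := ((n - 1) * n./2)%N.

(** The first n-1 rows after the square of size [N] vanish on its columns and
    continue with rows of the reversed X; hence the block triangular
    factorizations that follow. *)
Lemma chain_array_top r j : (r < n - 1)%N ->
  chain_array X n.+1 (N + r)%N j =
  if (j < N + n)%N then if (N <= j)%N then y r (j - N) else 0
  else y r.+1 (j - (N + n)).
Proof.
move=> ltr; rewrite /chain_array /band [N]mulnC divnMDl ?modnMDl; last by lia.
rewrite divn_small // modn_small // addn0.
set e := nat_of_bool (odd n.+1).
have en : (n + e = (n./2).*2 + 1)%N.
  by rewrite -{1}(odd_double_half n) /e /=; case: odd; lia.
have eQ : (n./2 * (n + 1) + 1 = n./2 * (n - 1) + n + e)%N.
  rewrite -addnA en -muln2 addnA -mulnDr; congr (_ * _ + 1)%N; lia.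
move: (n./2 * (n + 1))%N (n./2 * (n - 1))%N eQ => Q M eQ.
have -> : (Q < j + e)%N = ~~ (j < M + n)%N by lia.
have -> : (Q < j + e + n)%N = (M <= j)%N by lia.
case: ltnP => /= ?; last by congr rev_entry; lia.
by case: leqP => // ?; congr rev_entry; lia.
Qed.

Lemma chain_top s : (s < n)%N -> chain n.+1 s = chain n.+1 0 * lead_minor y s.
Proof.
move=> ltsn; rewrite /chain /chain_size -pred_Sn addn0.
rewrite lead_minor_ublock => [|r j ltr ltj]; last first.
  by rewrite chain_array_top ?[(j < _)%N]ltn_addr ?[(N <= j)%N]leqNgt ?ltj //; lia.
congr (_ * _); apply: eq_lead_minor => r j ltr ltj.
rewrite chain_array_top ?ifT //; try lia.
by congr rev_entry; lia.
Qed.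

Lemma skip_chain_top s : (s.+1 < n)%N ->
  skip_chain n.+1 s.+1 = chain n.+1 0 * skip_minor y s.+1.
Proof.
move=> ltsn; rewrite /skip_chain /chain /chain_size -pred_Sn addn0.
rewrite [skip_minor]lock addnS -lock /skip_minor -addnS lead_minor_ublock => [|r j ltr ltj]; last first.
  by rewrite bump_ltn ?chain_array_top ?[(j < _)%N]ltn_addr ?[(N <= j)%N]leqNgt ?ltj //; lia.
congr (_ * _).
  by apply: eq_lead_minor => r j ltr ltj; rewrite bump_ltn //; lia.
apply: eq_lead_minor => r j ltr ltj.
rewrite chain_array_top ?ifT; try by rewrite /bump; lia.
by congr rev_entry; rewrite /bump; lia.
Qed.

(** Diagonals 0 and n+1 are the same one, but their steps differ by one: in the
    grid, theta_(s+1) is in the row of step s of diagonal 1, whereas theta_s is in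
    the row of step s of diagonal n. *)
Definition diag d s : R :=
  if d == 0%N then lead_minor y s.+1
  else if d == n.+1 then lead_minor y s else chain d s.

Definition skip_diag d s : R :=
  if d == 0%N then skip_minor y s.+1
  else if d == n.+1 then skip_minor y s else skip_chain d s.

Lemma diag_square d s :
  lead_minor y n != 0 -> chain n.+1 0 != 0 -> (d <= n)%N -> (s.+2 <= n)%N ->
  diag d s.+1 * diag d.+1 s =
  diag d s * skip_diag d.+1 s.+1 - skip_diag d s * diag d.+1 s.+1.
Proof.
move=> detX_neq0 top_neq0 ledn lesn; rewrite /diag /skip_diag eqSS.
case: (posnP d) => [->|d_gt0]; last rewrite ltn_eqF ?ltnS //=.
  rewrite /= [(0 == n)%N]ltn_eqF; last by lia.
  have := theta_phi_square R n X n_ge2 s lesn.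
  rewrite /chain /skip_chain !lead_chain_array !skip_chain_array /=.
  by rewrite /chain_size muln0 !add0n.
have := chain_square R n X n_ge2 d s detX_neq0 d_gt0.
case: eqP => [->|//].
rewrite chain_top ?skip_chain_top ?(chain_top s.+1) // 1?ltnW // => e.
apply: (mulfI top_neq0); rewrite mulrCA e; ring.
Qed.

End Closing.

Arguments diag {R n} X d s.
Arguments skip_diag {R n} X d s.

(** * Nonvanishing at the antidiagonal matrix *)

Section Generic.
Variables (K : fieldType) (n : nat).
Hypothesis n_ge2 : (2 <= n)%N.

Lemma entry_map (R S : comNzRingType) (f : {rmorphism R -> S}) p q (A : 'M[R]_(p, q)) r c :
  entry (map_mx f A) r c = f (entry A r c).
Proof.
case: r c => [|r] [|c]; rewrite /entry ?rmorph0 //.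
case: (insub r : option 'I_p) => [i|]; last by rewrite rmorph0.
by case: (insub c : option 'I_q) => [j|]; rewrite ?rmorph0 // mxE.
Qed.

Lemma lead_minor_map (R S : comNzRingType) (f : {rmorphism R -> S}) g m :
  f (lead_minor g m) = lead_minor (fun i j => f (g i j)) m.
Proof.
rewrite /lead_minor -det_map_mx; congr (\det _).
by apply/matrixP => i j; rewrite !mxE.
Qed.

Lemma lead_minor_neq0 (g : nat -> nat -> K) m :
  (forall v : 'I_m -> K, (forall s, (s < m)%N -> \sum_(t < m) g s t * v t = 0) ->
     forall t, v t = 0) -> lead_minor g m != 0.
Proof.
move=> ker0; rewrite /lead_minor -det_tr; apply/det0P.
case=> v /negP v_neq0 vA0; apply: v_neq0; apply/eqP/rowP => t; rewrite mxE.
apply: (ker0 (fun t => v 0 t)) => s lts.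
have /rowP/(_ (Ordinal lts)) := vA0; rewrite !mxE => vA0s.
by rewrite -[RHS]vA0s; apply: eq_bigr => j _; rewrite !mxE mulrC.
Qed.

Definition antidiag : 'M[K]_n := \matrix_(i, j) (i + j == n - 1)%N%:R.
Local Notation y0 := (rev_entry antidiag).
Local Notation w0 := (band antidiag).

Lemma rev_entry_antidiag a b : y0 a b = (a + b == n - 1)%N%:R.
Proof.
rewrite /rev_entry; have [lean|ltan] := ltnP a n; last first.
  rewrite (_ : n - a = 0)%N ?entry0l; last by lia.
  by case: eqP => //; lia.
have [lebn|ltbn] := ltnP b n; last first.
  rewrite (_ : n - b = 0)%N ?entry0r; last by lia.
  by case: eqP => //; lia.
have lta : (n - a.+1 < n)%N by lia.
have ltb : (n - b.+1 < n)%N by lia.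
rewrite (_ : n - a = (n - a.+1).+1)%N; last by lia.
rewrite (_ : n - b = (n - b.+1).+1)%N; last by lia.
rewrite (entry_ord _ _ _ _ (Ordinal lta) (Ordinal ltb)) mxE /=.
by congr (nat_of_bool _)%:R; lia.
Qed.

Lemma lead_rev_entry_antidiag : lead_minor y0 n != 0.
Proof.
apply: lead_minor_neq0 => v ker t.
have lts : (n - 1 - t < n)%N by lia.
have := ker _ lts; rewrite (bigD1 t) //= rev_entry_antidiag.
have -> : (n - 1 - t + t == n - 1)%N by have := ltn_ord t; lia.
rewrite mul1r big1 ?addr0 // => j nejt.
rewrite rev_entry_antidiag; case: eqP => [ej|_]; last by rewrite mul0r.
by case/eqP: nejt; apply: val_inj => /=; have := ltn_ord t; lia.
Qed.

Lemma band_antidiag q r t : (r < n - 1)%N ->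
  w0 (q * (n - 1) + r) t =
  (t + r == q * (n + 1))%N%:R + (t + r.+2 == q.+1 * (n + 1))%N%:R.
Proof.
move=> ltr; rewrite /band divnMDl ?modnMDl; last by lia.
rewrite divn_small // modn_small // addn0 mulSn.
move: (q * (n + 1))%N => Q; rewrite !rev_entry_antidiag.
case: ltnP => ?.
  rewrite [X in X + _](_ : _ = 0) ?add0r; last by case: eqP => //; lia.
  by congr (nat_of_bool _)%:R; lia.
rewrite [X in _ + X](_ : _ = 0) ?addr0; last by case: eqP => //; lia.
case: ltnP => ?; first by congr (nat_of_bool _)%:R; lia.
by case: eqP => //; lia.
Qed.

(** For the antidiagonal X every row of the band contains at most two ones, n-1
    columns apart, so a kernel vector v satisfies the relations [step] between
    two of its coordinates.  From any column, following them in a suitable direction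
    leaves the square, and there v is 0. *)
Lemma chain_top_antidiag : chain antidiag n.+1 0 != 0.
Proof.
rewrite /chain /chain_size -pred_Sn addn0; set m := ((n - 1) * n.+1.-1./2)%N.
apply: lead_minor_neq0 => v ker.
pose e := nat_of_bool (odd n.+1).
pose k := n./2.
have en : (n + e = k.*2 + 1)%N.
  by rewrite -{1}(odd_double_half n) /e /=; case: odd; lia.
have em : (m = k * (n - 1))%N by rewrite mulnC.
(* the coordinate of v at column q(n+1) - c, or 0 if there is none *)
pose V c q : K := \sum_(t < m) (t + e + c == q * (n + 1))%N%:R * v t.
have step c q : (c <= n - 2)%N -> (q < k)%N -> V c q + V c.+2 q.+1 = 0.
  move=> lec ltq; rewrite -big_split /=.
  have lts : (q * (n - 1) + c < m)%N.
    rewrite em; apply: leq_trans (_ : q.+1 * (n - 1) <= _)%N; last by rewrite leq_mul2r ltq orbT.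
    by rewrite mulSn; lia.
  rewrite -[RHS](ker _ lts); apply: eq_bigr => t _.
  by rewrite /chain_array band_antidiag -?mulrDl //; lia.
have V0 c q : (forall t, (t < m)%N -> (t + e + c <> q * (n + 1))%N) -> V c q = 0.
  move=> ne; apply: big1 => t _.
  by have := ne t (ltn_ord t) => /eqP/negPf->; rewrite mul0r.
have below q : forall c, (c <= n)%N -> (q <= k)%N -> (q.*2 < c + e)%N -> V c q = 0.
  elim: q => [|q IHq] c lec leq lt_qc; first by apply: V0; lia.
  case: c lec lt_qc => [|[|c]] lec lt_qc; try by rewrite /e in lt_qc; lia.
  by have := step c q; rewrite IHq ?add0r; try lia; apply; lia.
have above p : forall q c, (k = q + p)%N -> (c + e <= q.*2)%N -> V c q = 0.
  elim: p => [|p IHp] q c ek le_cq.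
    apply: V0 => t ltt; rewrite em in ltt; have -> : q = k by lia.
    have : (k * (n + 1) = k * (n - 1) + k.*2)%N by rewrite -muln2 -mulnDr; congr muln; lia.
    by lia.
  have := step c q; rewrite (IHp q.+1 c.+2) ?addr0; try lia.
  by apply; lia.
have VE c q (t : 'I_m) : (t + e + c = q * (n + 1))%N -> V c q = v t.
  move=> et; rewrite /V (bigD1 t) //= et eqxx mul1r big1 ?addr0 // => j nejt.
  case: eqP => [ej|_]; last by rewrite mul0r.
  by case/eqP: nejt; apply: val_inj => /=; lia.
move=> t; have ltt := ltn_ord t.
pose q := ((t + e + n) %/ (n + 1))%N.
have eq := divn_eq (t + e + n) (n + 1).
have ltr : ((t + e + n) %% (n + 1) < n + 1)%N by rewrite ltn_pmod // addn1.
have leqk : (q <= k)%N.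
  rewrite /q -ltnS ltn_divLR ?addn1 // mulSn.
  have : (k * (n + 1) = k * (n - 1) + k.*2)%N by rewrite -muln2 -mulnDr; congr muln; lia.
  by lia.
(* write column t + e as q(n+1) - c with 0 <= c <= n *)
rewrite -(VE (n - (t + e + n) %% (n + 1))%N q); last by rewrite /q; lia.
set c := (n - _)%N; case: (ltnP q.*2 (c + e)) => hc.
  by apply: below => //; rewrite /c; lia.
by apply: (above (k - q)%N); lia.
Qed.

Lemma genX_antidiag :
  exists f : {rmorphism {mpoly K[n * n]} -> K}, map_mx f (genX K n) = antidiag.
Proof.
exists (meval (fun l => mxvec antidiag 0 l)).
apply/matrixP => i j; rewrite !mxE; apply: etrans (mevalXU _ _) _.
by rewrite mxvecE mxE.
Qed.

Lemma rev_entry_map (R S : comNzRingType) (f : {rmorphism R -> S}) (X : 'M[R]_n) a b :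
  rev_entry (map_mx f X) a b = f (rev_entry X a b).
Proof. exact: entry_map. Qed.

Lemma band_map (R S : comNzRingType) (f : {rmorphism R -> S}) (X : 'M[R]_n) s t :
  band (map_mx f X) s t = f (band X s t).
Proof.
by rewrite /band; case: ifP => _; [|case: ifP => _]; rewrite ?rev_entry_map ?rmorph0.
Qed.

Lemma lead_rev_entry_genX : lead_minor (rev_entry (genX K n)) n != 0.
Proof.
have [f fX] := genX_antidiag.
apply: contraNneq lead_rev_entry_antidiag => /(congr1 f).
rewrite rmorph0 lead_minor_map -fX => <-; apply/eqP.
by apply: eq_lead_minor => i j _ _; apply: rev_entry_map.
Qed.

Lemma chain_top_genX : chain (genX K n) n.+1 0 != 0.
Proof.
have [f fX] := genX_antidiag.
apply: contraNneq chain_top_antidiag => /(congr1 f).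
rewrite rmorph0 lead_minor_map -fX => <-; apply/eqP.
by apply: eq_lead_minor => i j _ _; apply: band_map.
Qed.

End Generic.

(** * Exchange relations along the diagonals *)

(** The auxiliary minor [g] occurs in the left and in the right relation with
    opposite signs. *)
Lemma exchange (S : comNzRingType) (l1 l0 f0 f1 f2 r0 r1 g gl gr : S) :
  l1 * f0 = l0 * g - gl * f1 -> f2 * r0 = f1 * gr - g * r1 ->
  l1 * f0 * r1 + f2 * r0 * l0 = f1 * (l0 * gr - gl * r1).
Proof. by move=> -> ->; ring. Qed.

(** What the quiver needs to know about the functions h d s.  Keeping [h] abstract
    separates the combinatorics of the arrows from the determinants.  The
    equation [family_wrap] identifies the end of diagonal d with the beginning of
    diagonal d+2, and [family_exchange_wrap] is the exchange relation at that end, where step n of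
    diagonal d gives way to step 1 of diagonal d+2, and the steps n-1 and n of
    diagonal d+1 give way to the steps 0 and 1 of diagonal d+3. *)
Record exchange_family (S : comNzRingType) (n : nat) (h : nat -> nat -> S) : Prop :=
  ExchangeFamily {
    family_main s : h 0 s = h n.+1 s.+1;
    family_start1 : h 1 0 = 1;
    family_start2 : h 2 0 = 1;
    family_start_main : h n.+1 0 = 1;
    family_wrap d : (0 < d)%N -> (d.+2 <= n)%N -> h d (n - 1)%N = h d.+2 0;
    family_exchange d s : (0 < d <= n)%N -> (0 < s)%N -> (s.+2 <= n)%N ->
      exists p, h d.-1 s * h d s.-1 * h d.+1 s.+1 +
                h d s.+1 * h d.+1 s * h d.-1 s.-1 = h d s * p;
    family_exchange_wrap d : (0 < d)%N -> (d.+2 <= n)%N ->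
      exists p, h d.-1 (n - 1)%N * h d (n - 1).-1 * h d.+3 1 +
                h d.+2 1 * h d.+3 0 * h d.-1 (n - 1).-1 = h d (n - 1)%N * p;
    family_exchange_main t : (0 < t < n)%N ->
      exists p, h n t * h n.+1 t.-1 * h 1 t +
                h 0 t * h 1 t.-1 * h n t.-1 = h n.+1 t * p }.

Arguments exchange_family {S} n h.
Arguments family_main {S n h} _ s.
Arguments family_start1 {S n h} _.
Arguments family_start2 {S n h} _.
Arguments family_start_main {S n h} _.
Arguments family_wrap {S n h} _ d.
Arguments family_exchange {S n h} _ d s.
Arguments family_exchange_wrap {S n h} _ d.
Arguments family_exchange_main {S n h} _ t.

Section DiagonalFamily.
Variables (R : idomainType) (n : nat) (X : 'M[R]_n).
Hypothesis n_ge2 : (2 <= n)%N.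
Hypothesis detX_neq0 : lead_minor (rev_entry X) n != 0.
Hypothesis top_neq0 : chain X n.+1 0 != 0.
Local Notation h := (diag X).
Local Notation sk := (skip_diag X).

Lemma diag_main s : h 0 s = h n.+1 s.+1.
Proof. by rewrite /diag /= eqxx. Qed.

Lemma skip_diag_main s : sk 0 s = sk n.+1 s.+1.
Proof. by rewrite /skip_diag /= eqxx. Qed.

Lemma diag_start d : d \in [:: 1; 2; n.+1]%N -> h d 0 = 1.
Proof.
rewrite !inE /diag; case/or3P => /eqP->; rewrite /= ?eqxx ?lead_minor0 //.
all: case: eqP => [|_]; rewrite ?lead_minor0 // /chain /chain_size /= muln0.
all: exact: lead_minor0.
Qed.

Lemma diag_wrap d : (0 < d)%N -> (d.+2 <= n)%N ->
  h d (n - 1)%N = h d.+2 0 /\ sk d (n - 1)%N = sk d.+2 0.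
Proof.
move=> d_gt0 ltdn; rewrite /diag /skip_diag !(@gtn_eqF 0) // !ltn_eqF /=; try lia.
rewrite /chain /skip_chain.
have -> : chain_size n d.+2 0 = chain_size n d (n - 1).
  by case: d d_gt0 ltdn => // d _ _; rewrite /chain_size /= mulnS; lia.
have eqA s t : chain_array X d.+2 s t = chain_array X d s t.
  by rewrite /chain_array /= negbK.
split; first by apply: eq_lead_minor => *.
by case: (chain_size _ _ _) => // m; apply: eq_lead_minor => *.
Qed.

Lemma left_square d s : (0 < d <= n)%N -> (0 < s < n)%N ->
  h d.-1 s * h d s.-1 = h d.-1 s.-1 * sk d s - sk d.-1 s.-1 * h d s.
Proof.
case: d => // d ledn; case: s => // s lts.
by apply: diag_square => //; lia.
Qed.

Lemma diag_exchange_family : exchange_family n h.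
Proof.
split.
- exact: diag_main.
- by apply: diag_start.
- by apply: diag_start.
- by apply: diag_start; rewrite !inE eqxx !orbT.
- by move=> d d_gt0 led; have [] := diag_wrap d d_gt0 led.
- move=> d s d_in s_gt0 les; eexists; apply: exchange.
    by apply: left_square => //; lia.
  by apply: diag_square => //; lia.
- move=> d d_gt0 led; eexists; apply: exchange.
    by apply: left_square => //; lia.
  have [-> ->] := diag_wrap d d_gt0 led.
  by apply: diag_square => //; lia.
move=> [|t] // ltt; rewrite -diag_main /=; eexists; apply: exchange.
  by rewrite [h 0 t]diag_main; apply: diag_square => //; lia.
by rewrite -skip_diag_main; apply: diag_square => //; lia.
Qed.

End DiagonalFamily.

(** * The arrows of the quiver *)

(** The arrows in coordinates counted from 1, as in [arrow], but for plain natural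
    numbers, so that they can be compared by linear arithmetic. *)
Definition nat_arrow (n i j i' j' : nat) : bool :=
  [|| [&& i == i', j == j' + 1 & (i', j') != (1, n - 1)],
      [&& i == i' + 1, j == j' & (i', j') != (1, 1)],
      [&& i' == i + 1 & j' == j + 1],
      [&& i == n, i' == 1, j' == j & 2 <= j <= n - 1],
      [&& i == 1, i' == n, j' == j + 1 & 2 <= j <= n - 1],
      [&& j == n, j' == 1, i' == i + 2 & 1 <= i <= n - 2] |
      [&& j == 1, j' == n, i == i' + 1 & 2 <= i' <= n - 1]]%N.

Definition in_grid (n : nat) (p : nat * nat) : bool :=
  ((0 < p.1 <= n) && (0 < p.2 <= n))%N.

Lemma prod_positions (S : comNzRingType) n (P : pred (vertex n)) (f : nat -> nat -> S)
    (s : seq (nat * nat)) :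
  uniq s -> all (in_grid n) s ->
  (forall u, P u = ((u.1.+1, u.2.+1) \in s)) ->
  \prod_(u | P u) f u.1.+1 u.2.+1 = \prod_(p <- s) f p.1 p.2.
Proof.
move=> uniq_s /allP s_in PE.
pose posn (u : vertex n) := ((nat_of_ord u.1).+1, (nat_of_ord u.2).+1).
rewrite -big_filter -(big_map posn xpredT (fun p => f p.1 p.2)).
apply: perm_big; apply: uniq_perm => //.
  rewrite map_inj_uniq ?filter_uniq ?index_enum_uniq //.
  by move=> [a b] [c d] [] /val_inj /= -> /val_inj /= ->.
move=> p; apply/mapP/idP => [[u]|ps].
  by rewrite mem_filter PE => /andP[uP _] ->.
have /= := s_in _ ps; case: p ps => [[|a] [|b]] ps; rewrite /in_grid /= ?andbF //.
case/andP=> lta ltb.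
exists (Ordinal lta, Ordinal ltb) => //.
by rewrite mem_filter PE /= ps mem_index_enum.
Qed.

Section Positions.
Variables (S : comNzRingType) (n : nat) (h : nat -> nat -> S).
Hypothesis n_ge2 : (2 <= n)%N.

(** Diagonals with d = j - i lie on or above the main diagonal of the grid, and
    those with d = n+1+j-i below it; steps are counted upwards. *)
Definition at_pos (i j : nat) : S :=
  if (i <= j)%N then h (j - i)%N (n - i)%N else h (n + 1 + j - i)%N (n + 1 - i)%N.

Definition listed_arrows (i j : nat) (out inn : seq (nat * nat)) : Prop :=
  [/\ uniq out && uniq inn, all (in_grid n) (out ++ inn),
      forall a b, in_grid n (a, b) -> nat_arrow n i j a b = ((a, b) \in out) &
      forall a b, in_grid n (a, b) -> nat_arrow n a b i j = ((a, b) \in inn)].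

Definition divides_at (i j : nat) : Prop :=
  exists out inn, listed_arrows i j out inn /\
    exists p, \prod_(q <- out) at_pos q.1 q.2 + \prod_(q <- inn) at_pos q.1 q.2
              = at_pos i j * p.

Lemma divides_at_exchange (v : vertex n) : divides_at v.1.+1 v.2.+1 ->
  exists p, \prod_(u | arrow v u) at_pos u.1.+1 u.2.+1 +
            \prod_(u | arrow u v) at_pos u.1.+1 u.2.+1 = at_pos v.1.+1 v.2.+1 * p.
Proof.
move=> [out [inn [[/andP[uniq_out uniq_in]]]]].
rewrite all_cat => /andP[out_in in_in] outE inE [p eqp].
exists p; rewrite (prod_positions _ _ _ _ out) ?(prod_positions _ _ _ _ inn) //.
  by move=> u; apply: inE; rewrite /in_grid /= !ltn_ord.
by move=> u; apply: outE; rewrite /in_grid /= !ltn_ord.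
Qed.

Hypothesis hP : exchange_family n h.

Lemma at_pos_upper i j d s : (i <= j)%N -> d = (j - i)%N -> s = (n - i)%N ->
  at_pos i j = h d s.
Proof. by rewrite /at_pos => -> -> ->. Qed.

Lemma at_pos_lower i j d s : (j <= i <= n)%N -> d = (n + 1 + j - i)%N ->
  s = (n + 1 - i)%N -> at_pos i j = h d s.
Proof.
rewrite /at_pos => ij_in -> ->; case: leqP => // leij.
have -> : i = j by lia.
by rewrite subnn (family_main hP); congr h; lia.
Qed.

(** In the first row the function is the last one on diagonal d-2, that is, step 0
    of diagonal d. *)
Lemma at_pos_first_row j d : (1 < j < n)%N -> d = j.+1 -> at_pos 1 j = h d 0.
Proof.
move=> j_in ->; rewrite (at_pos_upper 1 j (j - 1) (n - 1)) //; last by lia.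
rewrite (family_wrap hP (j - 1)); try lia.
by congr h; lia.
Qed.

(** Choosing the disjunct first keeps the arithmetic goals free of case
    distinctions. *)
Ltac pick_disjunct :=
  first [apply/orP; left; lia | apply/orP; right; pick_disjunct | lia].

Ltac compare_arrows :=
  let a := fresh "a" in let b := fresh "b" in
  move=> a b; rewrite /nat_arrow !inE !xpair_eqE => ab_in; apply/idP/idP;
  [ repeat case/orP; lia
  | repeat case/orP; case/andP => /eqP ? /eqP ?; pick_disjunct].

Ltac list_arrows :=
  split; rewrite /in_grid /= ?inE ?xpair_eqE;
  [lia | lia | compare_arrows | compare_arrows].

(** Each of the following lemmas lists the targets and the sources of the arrows
    at one kind of vertex, and recognises the corresponding exchange relation. *)
Lemma divides_upper i j : (1 < i)%N -> (i < j < n)%N -> divides_at i j.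
Proof.
move=> i_gt1 ltij. have [|||p eqp] := family_exchange hP (j - i) (n - i); try lia.
exists [:: (i, j.-1); (i.-1, j); (i.+1, j.+1)],
       [:: (i.+1, j); (i.-1, j.-1); (i, j.+1)]; split; first by list_arrows.
exists p; rewrite !big_cons !big_nil /=.
rewrite (at_pos_upper i j.-1 (j - i).-1 (n - i))%N; try lia.
rewrite (at_pos_upper i.-1 j (j - i).+1 (n - i).+1)%N; try lia.
rewrite (at_pos_upper i.+1 j.+1 (j - i) (n - i).-1)%N; try lia.
rewrite (at_pos_upper i.+1 j (j - i).-1 (n - i).-1)%N; try lia.
rewrite (at_pos_upper i.-1 j.-1 (j - i) (n - i).+1)%N; try lia.
rewrite (at_pos_upper i j.+1 (j - i).+1 (n - i))%N; try lia.
rewrite (at_pos_upper i j (j - i) (n - i))%N; try lia.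
by rewrite -eqp; ring.
Qed.

Lemma divides_last_col i : (1 < i)%N -> (i.+1 < n)%N -> divides_at i n.
Proof.
move=> i_gt1 ltin. have [|||p eqp] := family_exchange hP (n - i) (n - i); try lia.
exists [:: (i, n.-1); (i.-1, n); (i.+2, 1)],
       [:: (i.+1, n); (i.-1, n.-1); (i.+1, 1)]; split; first by list_arrows.
exists p; rewrite !big_cons !big_nil /=.
rewrite (at_pos_upper i n.-1 (n - i).-1 (n - i))%N; try lia.
rewrite (at_pos_upper i.-1 n (n - i).+1 (n - i).+1)%N; try lia.
rewrite (at_pos_lower i.+2 1 (n - i) (n - i).-1)%N; try lia.
rewrite (at_pos_upper i.+1 n (n - i).-1 (n - i).-1)%N; try lia.
rewrite (at_pos_upper i.-1 n.-1 (n - i) (n - i).+1)%N; try lia.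
rewrite (at_pos_lower i.+1 1 (n - i).+1 (n - i))%N; try lia.
rewrite (at_pos_upper i n (n - i) (n - i))%N; try lia.
by rewrite -eqp; ring.
Qed.

Lemma divides_above_corner : (2 < n)%N -> divides_at n.-1 n.
Proof.
move=> n_gt2. have [|||p eqp] := family_exchange hP 1 1; try lia.
exists [:: (n.-1, n.-1); (n.-2, n)],
       [:: (n, n); (n.-2, n.-1); (n, 1)]; split; first by list_arrows.
exists p; rewrite !big_cons !big_nil /=.
rewrite (at_pos_upper n.-1 n.-1 0 1)%N; try lia.
rewrite (at_pos_upper n.-2 n 2 2)%N; try lia.
rewrite (at_pos_upper n n 0 0)%N; try lia.
rewrite (at_pos_upper n.-2 n.-1 1 2)%N; try lia.
rewrite (at_pos_lower n 1 2 1)%N; try lia.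
rewrite (at_pos_upper n.-1 n 1 1)%N; try lia.
move: eqp; rewrite /= (family_start1 hP) !mulr1 => eqp.
by rewrite -eqp; ring.
Qed.

Lemma divides_first_row j : (1 < j)%N -> (j.+1 < n)%N -> divides_at 1 j.
Proof.
move=> j_gt1 ltjn. have [||p eqp] := family_exchange_wrap hP j.-1; try lia.
exists [:: (1, j.-1); (n, j.+1); (2, j.+1)],
       [:: (2, j); (n, j); (1, j.+1)]; split; first by list_arrows.
exists p; rewrite !big_cons !big_nil /=.
rewrite (at_pos_upper 1 j.-1 j.-1.-1 (n - 1))%N; try lia.
rewrite (at_pos_lower n j.+1 j.-1.+3 1)%N; try lia.
rewrite (at_pos_upper 2 j.+1 j.-1 (n - 1).-1)%N; try lia.
rewrite (at_pos_upper 2 j j.-1.-1 (n - 1).-1)%N; try lia.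
rewrite (at_pos_lower n j j.-1.+2 1)%N; try lia.
rewrite (at_pos_first_row j.+1 j.-1.+3)%N; try lia.
rewrite (at_pos_upper 1 j j.-1 (n - 1))%N; try lia.
by rewrite -eqp; ring.
Qed.

Lemma divides_first_row_last : (2 < n)%N -> divides_at 1 n.-1.
Proof.
move=> n_gt2. have [||p eqp] := family_exchange_wrap hP n.-2; try lia.
exists [:: (1, n.-2); (n, n); (2, n)],
       [:: (2, n.-1); (n, n.-1)]; split; first by list_arrows.
exists p; rewrite !big_cons !big_nil /=.
rewrite (at_pos_upper 1 n.-2 n.-2.-1 (n - 1))%N; try lia.
rewrite (at_pos_lower n n n.-2.+3 1)%N; try lia.
rewrite (at_pos_upper 2 n n.-2 (n - 1).-1)%N; try lia.
rewrite (at_pos_upper 2 n.-1 n.-2.-1 (n - 1).-1)%N; try lia.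
rewrite (at_pos_lower n n.-1 n.-2.+2 1)%N; try lia.
rewrite (at_pos_upper 1 n.-1 n.-2 (n - 1))%N; try lia.
have top1 : h n.-2.+3 0 = 1 by rewrite -(family_start_main hP); congr h; lia.
move: eqp; rewrite top1 mulr1 => eqp.
by rewrite -eqp; ring.
Qed.

Lemma divides_lower i j : (1 < j)%N -> (j < i < n)%N -> divides_at i j.
Proof.
move=> j_gt1 ltji. have [|||p eqp] := family_exchange hP (n + 1 + j - i) (n + 1 - i); try lia.
exists [:: (i, j.-1); (i.-1, j); (i.+1, j.+1)],
       [:: (i.+1, j); (i.-1, j.-1); (i, j.+1)]; split; first by list_arrows.
exists p; rewrite !big_cons !big_nil /=.
rewrite (at_pos_lower i j.-1 (n + 1 + j - i).-1 (n + 1 - i))%N; try lia.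
rewrite (at_pos_lower i.-1 j (n + 1 + j - i).+1 (n + 1 - i).+1)%N; try lia.
rewrite (at_pos_lower i.+1 j.+1 (n + 1 + j - i) (n + 1 - i).-1)%N; try lia.
rewrite (at_pos_lower i.+1 j (n + 1 + j - i).-1 (n + 1 - i).-1)%N; try lia.
rewrite (at_pos_lower i.-1 j.-1 (n + 1 + j - i) (n + 1 - i).+1)%N; try lia.
rewrite (at_pos_lower i j.+1 (n + 1 + j - i).+1 (n + 1 - i))%N; try lia.
rewrite (at_pos_lower i j (n + 1 + j - i) (n + 1 - i))%N; try lia.
by rewrite -eqp; ring.
Qed.

Lemma divides_first_col i : (2 < i < n)%N -> divides_at i 1.
Proof.
move=> i_in. have [|||p eqp] := family_exchange hP (n + 1 + 1 - i) (n + 1 - i); try lia.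
exists [:: (i.-1, n); (i.-1, 1); (i.+1, 2)],
       [:: (i.+1, 1); (i.-2, n); (i, 2)]; split; first by list_arrows.
exists p; rewrite !big_cons !big_nil /=.
rewrite (at_pos_upper i.-1 n (n + 1 + 1 - i).-1 (n + 1 - i))%N; try lia.
rewrite (at_pos_lower i.-1 1 (n + 1 + 1 - i).+1 (n + 1 - i).+1)%N; try lia.
rewrite (at_pos_lower i.+1 2 (n + 1 + 1 - i) (n + 1 - i).-1)%N; try lia.
rewrite (at_pos_lower i.+1 1 (n + 1 + 1 - i).-1 (n + 1 - i).-1)%N; try lia.
rewrite (at_pos_upper i.-2 n (n + 1 + 1 - i) (n + 1 - i).+1)%N; try lia.
rewrite (at_pos_lower i 2 (n + 1 + 1 - i).+1 (n + 1 - i))%N; try lia.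
rewrite (at_pos_lower i 1 (n + 1 + 1 - i) (n + 1 - i))%N; try lia.
by rewrite -eqp; ring.
Qed.

Lemma divides_last_row j : (2 < j < n)%N -> divides_at n j.
Proof.
move=> j_in. have [|||p eqp] := family_exchange hP j.+1 1; try lia.
exists [:: (n, j.-1); (n.-1, j); (1, j)],
       [:: (1, j.-1); (n.-1, j.-1); (n, j.+1)]; split; first by list_arrows.
exists p; rewrite !big_cons !big_nil /=.
rewrite (at_pos_lower n j.-1 j.+1.-1 1)%N; try lia.
rewrite (at_pos_lower n.-1 j j.+2 2)%N; try lia.
rewrite (at_pos_first_row j j.+1)%N; try lia.
rewrite (at_pos_first_row j.-1 j.+1.-1)%N; try lia.
rewrite (at_pos_lower n.-1 j.-1 j.+1 2)%N; try lia.
rewrite (at_pos_lower n j.+1 j.+2 1)%N; try lia.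
rewrite (at_pos_lower n j j.+1 1)%N; try lia.
by rewrite -eqp; ring.
Qed.

Lemma divides_last_row_second : (2 < n)%N -> divides_at n 2.
Proof.
move=> n_gt2. have [|||p eqp] := family_exchange hP 3 1; try lia.
exists [:: (n, 1); (n.-1, 2); (1, 2)],
       [:: (n.-1, 1); (n, 3)]; split; first by list_arrows.
exists p; rewrite !big_cons !big_nil /=.
rewrite (at_pos_lower n 1 2 1)%N; try lia.
rewrite (at_pos_lower n.-1 2 4 2)%N; try lia.
rewrite (at_pos_first_row 2 3)%N; try lia.
rewrite (at_pos_lower n.-1 1 3 2)%N; try lia.
rewrite (at_pos_lower n 3 4 1)%N; try lia.
rewrite (at_pos_lower n 2 3 1)%N; try lia.
move: eqp; rewrite /= (family_start2 hP) !mulr1 => eqp.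
by rewrite -eqp; ring.
Qed.

Lemma divides_bottom_left : (2 < n)%N -> divides_at n 1.
Proof.
move=> n_gt2. have [|||p eqp] := family_exchange hP 2 1; try lia.
exists [:: (n.-1, n); (n.-1, 1)],
       [:: (n.-2, n); (n, 2)]; split; first by list_arrows.
exists p; rewrite !big_cons !big_nil /=.
rewrite (at_pos_upper n.-1 n 1 1)%N; try lia.
rewrite (at_pos_lower n.-1 1 3 2)%N; try lia.
rewrite (at_pos_upper n.-2 n 2 2)%N; try lia.
rewrite (at_pos_lower n 2 3 1)%N; try lia.
rewrite (at_pos_lower n 1 2 1)%N; try lia.
move: eqp; rewrite /= (family_start1 hP) (family_start2 hP) !mulr1 => eqp.
by rewrite -eqp; ring.
Qed.

Lemma divides_diagonal i : (1 < i < n)%N -> divides_at i i.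
Proof.
move=> i_in. have [|p eqp] := family_exchange_main hP (n + 1 - i); first by lia.
exists [:: (i, i.-1); (i.-1, i); (i.+1, i.+1)],
       [:: (i.-1, i.-1); (i, i.+1); (i.+1, i)]; split; first by list_arrows.
exists p; rewrite !big_cons !big_nil /=.
rewrite (at_pos_lower i i.-1 n (n + 1 - i))%N; try lia.
rewrite (at_pos_upper i.-1 i 1 (n + 1 - i))%N; try lia.
rewrite (at_pos_lower i.+1 i.+1 n.+1 (n + 1 - i).-1)%N; try lia.
rewrite (at_pos_upper i.-1 i.-1 0 (n + 1 - i))%N; try lia.
rewrite (at_pos_upper i i.+1 1 (n + 1 - i).-1)%N; try lia.
rewrite (at_pos_lower i.+1 i n (n + 1 - i).-1)%N; try lia.
rewrite (at_pos_lower i i n.+1 (n + 1 - i))%N; try lia.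
by rewrite -eqp; ring.
Qed.

Lemma divides_corner : (2 < n)%N -> divides_at n n.
Proof.
move=> n_gt2. have [|p eqp] := family_exchange_main hP 1; first by lia.
exists [:: (n, n.-1); (n.-1, n)],
       [:: (n.-1, n.-1); (1, n.-1)]; split; first by list_arrows.
exists p; rewrite !big_cons !big_nil /=.
rewrite (at_pos_lower n n.-1 n 1)%N; try lia.
rewrite (at_pos_upper n.-1 n 1 1)%N; try lia.
rewrite (at_pos_upper n.-1 n.-1 0 1)%N; try lia.
rewrite (at_pos_first_row n.-1 n)%N; try lia.
rewrite (at_pos_lower n n n.+1 1)%N; try lia.
move: eqp; rewrite /= (family_start1 hP) (family_start_main hP) !mulr1 => eqp.
by rewrite -eqp; ring.
Qed.

Lemma divides_corner_two : n = 2%N -> divides_at n n.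
Proof.
move=> n_eq2. have [|p eqp] := family_exchange_main hP 1; first by lia.
exists [:: (n, n.-1); (n.-1, n)],
       [:: (n.-1, n.-1)]; split; first by list_arrows.
exists p; rewrite !big_cons !big_nil /=.
have startn : h n 0 = 1 by rewrite n_eq2 (family_start2 hP).
rewrite (at_pos_lower n n.-1 n 1)%N; try lia.
rewrite (at_pos_upper n.-1 n 1 1)%N; try lia.
rewrite (at_pos_upper n.-1 n.-1 0 1)%N; try lia.
rewrite (at_pos_lower n n n.+1 1)%N; try lia.
move: eqp; rewrite /= (family_start1 hP) startn (family_start_main hP) !mulr1 => eqp.
by rewrite -eqp; ring.
Qed.

(** The three excluded vertices carry the frozen functions. *)
Lemma divides_mutable i j : in_grid n (i, j) ->
  (i, j) \notin [:: (1, 1); (1, n); (2, 1)]%N -> divides_at i j.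
Proof.
rewrite /in_grid /= !inE !xpair_eqE => ij_in unfrozen.
case: (ltngtP i j) => [ltij|ltji|eij].
- have [ei|i_gt1] : i = 1%N \/ (1 < i)%N by lia.
    rewrite ei; have [->|ltj] : j = n.-1 \/ (j.+1 < n)%N by lia.
      by apply: divides_first_row_last; lia.
    by apply: divides_first_row; lia.
  have [ej|ltjn] : j = n \/ (j < n)%N by lia.
    rewrite ej; have [->|lti] : i = n.-1 \/ (i.+1 < n)%N by lia.
      by apply: divides_above_corner; lia.
    exact: divides_last_col.
  by apply: divides_upper; lia.
- have [ei|ltin] : i = n \/ (i < n)%N by lia.
    rewrite ei; have [ej|[ej|j_gt2]] : j = 1%N \/ j = 2%N \/ (2 < j)%N by lia.
    + by rewrite ej; apply: divides_bottom_left; lia.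
    + by rewrite ej; apply: divides_last_row_second; lia.
    by apply: divides_last_row; lia.
  have [ej|j_gt1] : j = 1%N \/ (1 < j)%N by lia.
    by rewrite ej; apply: divides_first_col; lia.
  by apply: divides_lower; lia.
rewrite -eij; have [ltin|ein] : (i < n)%N \/ i = n by lia.
  by apply: divides_diagonal; lia.
rewrite ein; have [n_eq2|n_gt2] : n = 2%N \/ (2 < n)%N by lia.
  exact: divides_corner_two.
exact: divides_corner.
Qed.

End Positions.

Arguments at_pos {S} n h i j.

(** * Positions of the cluster functions *)

Section Labels.
Variable n : nat.
Hypothesis n_ge2 : (2 <= n)%N.

(** Diagonal and step of a function. *)
Definition label_coord (l : label n) : nat * nat :=
  match l with
  | inl (inl i) => (0%N, nat_of_ord i)
  | inl (inr i) => ((i %/ (n - 1)).*2.+1, (i %% (n - 1)).+1)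
  | inr i => ((i %/ (n - 1)).*2.+2, (i %% (n - 1)).+1)
  end.

(** The inverse of the coordinate change in [at_pos]: on diagonal d the steps s < d
    are under the main diagonal of the grid, the others on or above it. *)
Definition label_pos (l : label n) : nat * nat :=
  let: (d, s) := label_coord l in
  if (s < d)%N then (n + 1 - s, d - s)%N else (n - s, n + d - s)%N.

Lemma kk_half : kk n = uphalf n.
Proof. by rewrite /kk addn1 divn2. Qed.

Lemma MM_half : MM n = ((n - 1) * n./2)%N.
Proof.
rewrite /MM /NN kk_half uphalf_half.
case: odd => /=; last by rewrite mulnC.
have : (0 < n./2 * (n - 1))%N by rewrite muln_gt0; lia.
by rewrite mulnDl mul1n [RHS]mulnC; lia.
Qed.

Lemma NN_half : NN n = ((n - 1) * uphalf n)%N.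
Proof. by rewrite /NN kk_half mulnC. Qed.

Lemma leq_MM_NN : (MM n <= NN n)%N.
Proof. by rewrite MM_half NN_half leq_mul2l uphalf_half leq_addl orbT. Qed.

Lemma label_coord_in l : let: (d, s) := label_coord l in
  if l is inl (inl _) then ((d == 0) && (s < n))%N else ((0 < d <= n) && (0 < s < n))%N.
Proof.
have n1_gt0 : (0 < n - 1)%N by lia.
have lt_mod i : (i %% (n - 1) < n - 1)%N by rewrite ltn_mod.
have en := odd_double_half n; have eu := uphalf_half n.
case: l => [[i|i]|i] /=.
- by rewrite ltn_ord.
- have := lt_mod i; have : (i %/ (n - 1) < uphalf n)%N.
    by rewrite ltn_divLR // mulnC -NN_half.
  lia.
have := lt_mod i; have : (i %/ (n - 1) < n./2)%N.
  by rewrite ltn_divLR // mulnC -MM_half.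
lia.
Qed.

Lemma label_pos_in l :
  (0 < (label_pos l).1 <= n)%N && (0 < (label_pos l).2 <= n)%N.
Proof.
have := label_coord_in l; rewrite /label_pos; case: (label_coord l) => d s.
by case: l => [[i|i]|i] /= ds_in; case: (ltnP s d) => ? /=; lia.
Qed.

Lemma label_pos_surj i j : (0 < i <= n)%N -> (0 < j <= n)%N ->
  exists l, label_pos l = (i, j).
Proof.
move=> i_in j_in; have n1_gt0 : (0 < n - 1)%N by lia.
have coordE d s : (0 < d <= n)%N -> (0 < s < n)%N ->
    exists l, label_coord l = (d, s).
  move=> d_in s_in; pose i0 := ((d.-1)./2 * (n - 1) + s.-1)%N.
  have e1 : (i0 %/ (n - 1) = (d.-1)./2)%N.
    by rewrite divnMDl // divn_small ?addn0 //; lia.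
  have e2 : (i0 %% (n - 1) = s.-1)%N by rewrite modnMDl modn_small //; lia.
  have en := odd_double_half n; have eu := uphalf_half n.
  have ed := odd_double_half d.-1.
  case: (boolP (odd d.-1)) => odd_d; rewrite ?odd_d ?(negPf odd_d) in ed.
    have lti : (i0 < MM n)%N by rewrite MM_half mulnC -ltn_divLR // e1; lia.
    by exists (inr (Ordinal lti)); rewrite /= e1 e2; congr pair; lia.
  have lti : (i0 < NN n)%N by rewrite NN_half mulnC -ltn_divLR // e1; lia.
  by exists (inl (inr (Ordinal lti))); rewrite /= e1 e2; congr pair; lia.
have [->|nij] := eqVneq i j.
  have lti : (n - j < n)%N by lia.
  by exists (inl (inl (Ordinal lti))); rewrite /label_pos /=; congr pair; lia.
have [ltij|leji] := ltnP i j.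
  have [||l el] := coordE (j - i)%N (n - i)%N; try lia.
  by exists l; rewrite /label_pos el ifF; [congr pair|]; lia.
have [||l el] := coordE (n + 1 + j - i)%N (n + 1 - i)%N; try lia.
by exists l; rewrite /label_pos el ifT; [congr pair|]; lia.
Qed.

Lemma frozen_label l :
  label_pos l \in [:: (1, 1); (1, n); (2, 1)]%N -> frozen l.
Proof.
have := label_coord_in l; rewrite /label_pos /=.
have n1_gt0 : (0 < n - 1)%N by lia.
have en := odd_double_half n; have eu := uphalf_half n.
have last_i i q : (i %/ (n - 1) = q)%N -> (i %% (n - 1)).+1 = (n - 1)%N ->
    (i.+1 = (n - 1) * q.+1)%N.
  by move=> eq er; rewrite {1}(divn_eq i (n - 1)) eq -addnS er mulnC -mulnSr.
rewrite !inE; case: l => [[i|i]|i] /=.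
- by have := ltn_ord i; rewrite !xpair_eqE; lia.
- have := last_i i _ erefl; move: (i %/ (n - 1))%N (i %% (n - 1))%N => q r lasti.
  case: (ltnP r.+1 q.*2.+1) => ? ds_in; rewrite !xpair_eqE => pos_in.
    by apply/eqP; rewrite lasti ?NN_half; [congr muln|]; lia.
  by apply/eqP; rewrite lasti ?NN_half; [congr muln|]; lia.
have := last_i i _ erefl; move: (i %/ (n - 1))%N (i %% (n - 1))%N => q r lasti.
case: (ltnP r.+1 q.*2.+2) => ? ds_in; rewrite !xpair_eqE => pos_in.
  by apply/eqP; rewrite lasti ?MM_half; [congr muln|]; lia.
by apply/eqP; rewrite lasti ?MM_half; [congr muln|]; lia.
Qed.

Variables (R : idomainType) (X : 'M[R]_n).

(** The entry met by a leading minor when it grows by one row and one column. *)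
Lemma band_diagonal q r (e : bool) d s :
  (r < n - 1)%N -> (d = q.*2 + 2 - e)%N -> s = r.+1 -> (d <= n)%N ->
  band X (q * (n - 1) + r) (q * (n - 1) + r + e) =
  if (s < d)%N then entry X (n + 1 - s) (d - s) else entry X (n - s) (n + d - s).
Proof.
move=> ltr ed es ledn; rewrite /band divnMDl ?modnMDl; last by lia.
rewrite divn_small // modn_small // addn0 /rev_entry.
have : (q * (n + 1) = q * (n - 1) + q.*2)%N.
  by rewrite -muln2 -mulnDr; congr muln; lia.
move: (q * (n + 1))%N (q * (n - 1))%N => Q M eQ.
case: ltnP => ?; case: ltnP => ?; try lia; first by congr (entry _ _ _); lia.
by rewrite ifT; [congr (entry _ _ _)|]; lia.
Qed.

Lemma top_left_entry l :
  entry (label_mx X l) 1 1 = entry X (label_pos l).1 (label_pos l).2.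
Proof.
have n1_gt0 : (0 < n - 1)%N by lia.
have lt_mod i : (i %% (n - 1) < n - 1)%N by rewrite ltn_mod.
have e11 m (A : 'M[R]_m.+1) : entry A 1 1 = A ord0 ord0.
  exact: (entry_ord _ _ _ _ ord0 ord0).
have le_NC := leq_NN_kk n n_ge2.
have le_MN := leq_MM_NN.
have := label_coord_in l; rewrite /label_pos.
case: l => [[i|i]|i] /= ds_in; rewrite e11 mxE !addn0.
- by congr (entry _ _ _); have := ltn_ord i; lia.
- rewrite (_ : _ - _ + 1 = NN n - i)%N; last by have := ltn_ord i; lia.
  rewrite (_ : _ - _ + 1 = kk n * (n + 1) + 1 - i.+1)%N; last first.
    by have := ltn_ord i; lia.
  rewrite entry_U //; last by have := ltn_ord i; lia.
  have := band_diagonal (i %/ (n - 1)) _ true (i %/ (n - 1)).*2.+1 _ (lt_mod i) _ erefl.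
  rewrite -divn_eq [nat_of_bool _]/= addn1; move: ds_in.
  move: (i %/ (n - 1))%N (i %% (n - 1))%N => q r ds_in -> //; try lia.
  by case: ifP.
rewrite (_ : _ - _ + 1 = NN n - i)%N; last by have := ltn_ord i; lia.
rewrite (_ : _ - _ + 2 = kk n * (n + 1) + 1 - i)%N; last first.
  by have := ltn_ord i; lia.
rewrite entry_U //; try by have := ltn_ord i; lia.
have := band_diagonal (i %/ (n - 1)) _ false (i %/ (n - 1)).*2.+2 _ (lt_mod i) _ erefl.
rewrite -divn_eq [nat_of_bool _]/= addn0; move: ds_in.
move: (i %/ (n - 1))%N (i %% (n - 1))%N => q r ds_in -> //; try lia.
by case: ifP.
Qed.

Lemma cluster_funE l :
  cluster_fun X l = at_pos n (diag X) (label_pos l).1 (label_pos l).2.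
Proof.
have n1_gt0 : (0 < n - 1)%N by lia.
have le_MN := leq_MM_NN.
transitivity (diag X (label_coord l).1 (label_coord l).2).
  have := label_coord_in l; rewrite /cluster_fun /diag.
  case: l => [[i|i]|i] /= ds_in.
  - by rewrite det_theta.
  - rewrite det_phi // ltn_eqF; last by lia.
    rewrite /chain lead_chain_array /chain_size /= odd_double doubleK mulnC addnS.
    by rewrite -divn_eq.
  rewrite det_psi //; last by have := ltn_ord i; lia.
  rewrite ltn_eqF; last by lia.
  rewrite /chain lead_chain_array /chain_size /= odd_double uphalf_double mulnC addnS.
  by rewrite -divn_eq.
have := label_coord_in l; rewrite /label_pos; case: (label_coord l) => d s /=.
move=> ds_in; have {}ds_in : (d <= n)%N && (s < n)%N by case: l ds_in => [[]|]; lia.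
rewrite /at_pos; case: ltnP => ? /=; [rewrite ifF|rewrite ifT]; try lia.
all: by congr diag; lia.
Qed.

End Labels.

Section Vertices.
Variables (K : fieldType) (n : nat).
Hypothesis n_ge2 : (2 <= n)%N.
Local Notation G := (genX K n).
Local Notation F := (at_pos n (diag G)).

Lemma genX_inj (i j i' j' : 'I_n) : G i j = G i' j' -> (i, j) = (i', j').
Proof.
rewrite !mxE => /(congr1 (mcoeff U_(mxvec_index i j))).
rewrite !mcoeffXU eqxx; case: eqP => [e _|_ /eqP]; last by rewrite oner_eq0.
by case: (enum_rank_inj (cast_ord_inj e)) => -> ->.
Qed.

Lemma attachedE (l : label n) (v : vertex n) :
  attached K l v = (label_pos n l == (v.1.+1, v.2.+1)%N).
Proof.
rewrite /attached top_left_entry //.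
have := label_pos_in n n_ge2 l; case: (label_pos n l) => [[|i] [|j]] //=; rewrite ?andbF //.
case/andP=> lti ltj; rewrite (entry_ord _ _ _ G (Ordinal lti) (Ordinal ltj)).
apply/eqP/eqP => [/genX_inj []|[ei ej]].
  by case: v => [v1 v2] /= <- <-.
by case: v ei ej => [v1 v2] /= ei ej; congr (genX K n _ _); apply: val_inj.
Qed.

Lemma fun_atE v : fun_at K v = F v.1.+1 v.2.+1.
Proof.
rewrite /fun_at; case: pickP => [l|].
  by rewrite attachedE cluster_funE // => /eqP->.
have [l el] := label_pos_surj n n_ge2 v.1.+1 v.2.+1 (ltn_ord v.1) (ltn_ord v.2).
by move/(_ l); rewrite attachedE el eqxx.
Qed.

(** If f_v were 0 then its inverse would be 0 as well, hence the mutation too. *)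
Lemma regular_mutation (v : vertex n) p :
  \prod_(u | arrow v u) F u.1.+1 u.2.+1 + \prod_(u | arrow u v) F u.1.+1 u.2.+1
    = F v.1.+1 v.2.+1 * p ->
  is_regular (mutation K v).
Proof.
move=> eqp; have fE := fun_atE.
rewrite /mutation (eq_bigr _ (fun u _ => fE u)) [X in _ + X](eq_bigr _ (fun u _ => fE u)).
rewrite eqp -fE; have [->|f_neq0] := eqVneq (fun_at K v) 0.
  by exists 0; rewrite mul0r rmorph0 mulr0.
by exists p; rewrite rmorphM mulKf // tofrac_eq0.
Qed.

End Vertices.

Local Open Scope complex_scope.

Theorem theorem3p6 (R : realType) (n : nat) (hn : (2 <= n)%N) (l : label n) :
  ~~ frozen l ->
  exists2 v : vertex n,
    @attached R[i] n l v & is_regular (@mutation R[i] n v).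
Proof.
move=> unfrozen; have := label_pos_in n hn l.
case lE: (label_pos n l) => [[|i] [|j]] //=.
  by rewrite andbF.
case/andP=> lti ltj; exists (Ordinal lti, Ordinal ltj).
  by rewrite attachedE // lE.
have family := diag_exchange_family _ _ _ hn (lead_rev_entry_genX R[i] n hn)
  (chain_top_genX R[i] n hn).
have [|p eqp] := divides_at_exchange _ _ (diag (genX R[i] n)) (Ordinal lti, Ordinal ltj).
  apply: divides_mutable => //; first by rewrite /in_grid /= lti ltj.
  by apply: contra unfrozen; rewrite -lE; apply: frozen_label.
exact: regular_mutation eqp.
Qed.
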